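(* Let $F$ be a hypergraph with no two separated edges, i.e. there are no two edges $E_1,E_2$ of $F$ with $E_1<E_2$ (every element of $E_1$ smaller than every element of $E_2$). Let $p=v(F)$ and $q=e(F)>1$. Then for every $n\in\mathbb{N}$, $$\mathrm{ex}_i(F,n)\le (2p-1)(q-1)\cdot\mathrm{ex}_e(F,n).$$
   Context: A hypergraph $H=(E_i: i\in I)$ is a finite list of finite nonempty subsets of $\mathbb{N}$ (edges; repetitions allowed); it is simple if its edges are pairwise distinct. Its vertex set is $\bigcup H=\bigcup_i E_i$, $v(H)=|\bigcup H|$, $e(H)=|I|$, and $i(H)=\sum_{i\in I}|E_i|$. $H$ contains $H'=(E'_i:i\in I')$, written $H\succ H'$, if there exist an increasing injection $\phi:\bigcup H'\to\bigcup H$ and an injection $f:I'\to I$ such that $v\in E'_i$ implies $\phi(v)\in E_{f(i)}$ for all $v$ and $i\in I'$; otherwise $H$ is $H'$-free. For a hypergraph $F$, $\mathrm{ex}_e(F,n)=\max\{e(H): H\not\succ F,\ H \text{ simple},\ v(H)\le n\}$ and $\mathrm{ex}_i(F,n)=\max\{i(H): H\not\succ F,\ H\text{ simple},\ v(H)\le n\}$. *)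

(* Defs.v *)
From mathcomp Require Import all_boot finmap.
From mathcomp Require Import boolp classical_sets.

Set Implicit Arguments.
Unset Strict Implicit.
Unset Printing Implicit Defensive.

Local Open Scope fset_scope.

Record hypergraph := Hypergraph {
  edges :> seq {fset nat};
  edges_neq0 : fset0 \notin edges
}.

Definition edge (H : hypergraph) (i : 'I_(size H)) : {fset nat} :=
  nth fset0 H i.

Definition vertices (H : hypergraph) : {fset nat} := \bigcup_(E <- H) E.

Definition nvert (H : hypergraph) : nat := #|` vertices H|.
Definition nedge (H : hypergraph) : nat := size H.
Definition nincid (H : hypergraph) : nat := \sum_(E <- H) #|` E|.

Definition simple (H : hypergraph) : Prop := uniq H.

(* [phi] is only constrained on [vertices H']; its values elsewhere are
   irrelevant. *)
Definition contains (H H' : hypergraph) : Prop :=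
  exists (phi : nat -> nat) (f : 'I_(size H') -> 'I_(size H)),
    [/\ {in vertices H', forall v, phi v \in vertices H},
        {in vertices H' &, {homo phi : u v / u < v}},
        injective f
      & forall v i, v \in edge i -> phi v \in edge (f i)].

Definition free (F H : hypergraph) : Prop := ~ contains H F.

Definition separated (E1 E2 : {fset nat}) : Prop :=
  {in E1 & E2, forall x y, x < y}.

Definition is_max (A : set nat) (m : nat) : Prop :=
  A m /\ forall k, A k -> k <= m.

(* Defaults to 0 when [A] has no maximum. *)
Definition max_nat (A : set nat) : nat := xget 0 (is_max A).

Definition admissible (F : hypergraph) (n : nat) (H : hypergraph) : Prop :=
  [/\ free F H, simple H & nvert H <= n].

Definition ex_e (F : hypergraph) (n : nat) : nat :=
  max_nat [set nedge H | H in admissible F n]%classic.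

Definition ex_i (F : hypergraph) (n : nat) : nat :=
  max_nat [set nincid H | H in admissible F n]%classic.

(* The maxima defining [ex_e] and [ex_i] are attained as soon as [F] has an
   edge; the default value of [max_nat] is then never used. *)

Lemma max_natP (A : set nat) (b : nat) :
  (exists m, A m) -> (forall m, A m -> m <= b) -> is_max A (max_nat A).
Proof.
move=> exA ubA; rewrite /max_nat; apply: xgetPex.
have exA' : exists m, `[< A m >] by case: exA => m /asboolP; exists m.
have ubA' m : `[< A m >] -> m <= b by move/asboolP/ubA.
case: (ex_maxnP exA' ubA') => m /asboolP Am max_m.
by exists m; split=> // k Ak; apply/max_m/asboolP.
Qed.

Lemma edge_sub_vertices (H : hypergraph) (E : {fset nat}) :
  E \in edges H -> E `<=` vertices H.
Proof. by move=> EH; exact: (@bigfcup_sup _ _ _ _ _ id EH). Qed.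

Lemma nedge_bound (H : hypergraph) (n : nat) :
  simple H -> nvert H <= n -> nedge H <= 2 ^ n.
Proof.
move=> uH vH; have -> : nedge H = #|` [fset E in edges H]|.
  by rewrite card_fseq undup_id.
apply: (@leq_trans #|` fpowerset (vertices H)|).
  apply/fsubset_leq_card/fsubsetP => E; rewrite !inE /= fpowersetE.
  exact: edge_sub_vertices.
by rewrite card_fpowerset leq_exp2l.
Qed.

Lemma nincid_bound (H : hypergraph) (n : nat) :
  simple H -> nvert H <= n -> nincid H <= 2 ^ n * n.
Proof.
move=> uH vH; apply: (@leq_trans (nedge H * n)); last first.
  by rewrite leq_mul2r nedge_bound ?orbT.
rewrite /nincid /nedge -sum1_size big_distrl /=.
rewrite big_seq [X in _ <= X]big_seq; apply: leq_sum => E EH; rewrite mul1n.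
exact: leq_trans (fsubset_leq_card (edge_sub_vertices EH)) vH.
Qed.

Definition hypergraph0 : hypergraph := @Hypergraph [::] isT.

Lemma admissible0 (F : hypergraph) (n : nat) :
  0 < nedge F -> admissible F n hypergraph0.
Proof.
move=> F_gt0; split=> //; last by rewrite /nvert /vertices big_nil cardfs0.
by case=> phi [f _]; case: (f (Ordinal F_gt0)).
Qed.

Lemma ex_eP (F : hypergraph) (n : nat) : 0 < nedge F ->
  is_max [set nedge H | H in admissible F n]%classic (ex_e F n).
Proof.
move=> F_gt0; apply: (@max_natP _ (2 ^ n)).
  by exists (nedge hypergraph0); exists hypergraph0 => //; apply: admissible0.
by move=> _ [H [_ sH vH] <-]; apply: nedge_bound.
Qed.

Lemma ex_iP (F : hypergraph) (n : nat) : 0 < nedge F ->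
  is_max [set nincid H | H in admissible F n]%classic (ex_i F n).
Proof.
move=> F_gt0; apply: (@max_natP _ (2 ^ n * n)).
  by exists (nincid hypergraph0); exists hypergraph0 => //; apply: admissible0.
by move=> _ [H [_ sH vH] <-]; apply: nincid_bound.
Qed.

(* Main.v *)
Require Import Defs.
From mathcomp Require Import all_boot finmap.
From mathcomp Require Import boolp classical_sets.
From mathcomp Require Import zify.

(** Cut every edge of an extremal [H] into consecutive blocks of size [p], at
    most [2p - 1] vertices of the edge per block; edges with fewer than [p]
    vertices are left whole.  Among the blocks each set occurs at most [q - 1]
    times, since a [p]-set lying in [q] edges of [H] already yields a copy of
    [F].  The hypergraph of distinct blocks is still [F]-free: two blocks of one
    edge are separated, so a copy of [F], which has no separated edges, uses
    blocks of distinct edges of [H] and hence gives a copy of [F] in [H]. *)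

Set Implicit Arguments.
Unset Strict Implicit.
Unset Printing Implicit Defensive.

Local Open Scope fset_scope.

(** Lets a copy of [F] be given by edges as sets: [index] recovers positions injectively, and [phi]
    lands in [vertices H] because every vertex of [F] lies in an edge. *)
Lemma contains_of_edges (H F : hypergraph) (phi : nat -> nat)
    (g : 'I_(size F) -> {fset nat}) :
  {in vertices F &, {homo phi : u v / u < v}} ->
  injective g -> (forall i, g i \in edges H) ->
  (forall v i, v \in edge i -> phi v \in g i) -> contains H F.
Proof.
move=> phi_homo g_inj gH phi_g.
have idx i : index (g i) H < size H by rewrite index_mem.
exists phi, (fun i => Ordinal (idx i)); split=> //.
- move=> v /bigfcupP [E]; rewrite andbT => EF vE.
  have iF : index E F < size F by rewrite index_mem.
  apply: (fsubsetP (edge_sub_vertices (gH (Ordinal iF)))).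
  by apply: phi_g; rewrite /edge /= nth_index.
- move=> i j [] eq_idx; apply: g_inj.
  by rewrite -(nth_index fset0 (gH i)) eq_idx nth_index.
- by move=> v i vi; rewrite /edge /= nth_index //; apply: phi_g.
Qed.

Lemma increasing_map_between (V B : {fset nat}) :
  #|` V| <= #|` B| ->
  exists phi : nat -> nat,
    {in V, forall v, phi v \in B} /\ {in V &, {homo phi : u v / u < v}}.
Proof.
move=> leVB.
have lt_sorted (A : {fset nat}) : sorted ltn (sort leq A).
  by rewrite ltn_sorted_uniq_leq sort_uniq fset_uniq sort_sorted //; exact: leq_total.
have ltB v : v \in V -> index v (sort leq V) < size (sort leq B).
  move=> vV; rewrite (@leq_trans (size (sort leq V))) ?index_mem ?mem_sort //.
  by rewrite !size_sort.
(* Send the k-th smallest element of [V] to the k-th smallest of [B]. *)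
exists (fun v => nth 0 (sort leq B) (index v (sort leq V))); split=> [v vV|u v uV vV uv].
  by rewrite -(mem_sort leq) mem_nth ?ltB.
apply: (sorted_ltn_nth ltn_trans) => //; rewrite ?inE ?ltB //.
rewrite ltnNge; apply/negP => le_vu.
have := @sorted_leq_nth _ leq leq_trans leqnn 0 (sort leq V) (sort_sorted leq_total V)
  (index v (sort leq V)) (index u (sort leq V)).
rewrite !inE !index_mem !mem_sort !nth_index ?mem_sort // => /(_ vV uV le_vu).
by rewrite leqNgt uv.
Qed.

(** With all vertices of [F] mapped increasingly into [B], every incidence is preserved whichever
    members of [s] the edges of [F] are sent to. *)
Lemma contains_of_common_subset (H F : hypergraph) (B : {fset nat})
    (s : seq {fset nat}) :
  nvert F <= #|` B| -> uniq s -> {subset s <= edges H} ->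
  (forall E, E \in s -> B `<=` E) -> nedge F <= size s -> contains H F.
Proof.
move=> leFB us sH sB les.
have [phi [phiB phi_homo]] := increasing_map_between leFB.
have lts (i : 'I_(size F)) : i < size s by apply: leq_trans les.
apply: (@contains_of_edges H F phi (fun i => nth fset0 s i)) => //.
- by move=> i j /eqP; rewrite nth_uniq // => /eqP /val_inj.
- by move=> i; apply: sH; rewrite mem_nth.
- move=> v i vi; apply: (fsubsetP (sB _ (mem_nth _ (lts i)))); apply: phiB.
  exact: (fsubsetP (edge_sub_vertices (mem_nth fset0 (ltn_ord i)))) vi.
Qed.

(** The blocks need not cover [E]: fewer than [p] vertices may be left over, and charging them to
    one full block gives [p + (p - 1) = 2 * p - 1]. *)
Definition is_cut (p : nat) (E : {fset nat}) (L : seq {fset nat}) : Prop :=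
  [/\ uniq L,
      {in L, forall B, [/\ B `<=` E, B != fset0 & #|` B| = p \/ B = E /\ #|` B| < p]},
      {in L &, forall B B', B != B' -> separated B B' \/ separated B' B}
    & #|` E| <= (2 * p - 1) * size L].

Lemma sorted_cut (p : nat) (s : seq nat) :
  0 < p -> p <= size s -> sorted ltn s ->
  exists L : seq {fset nat},
    [/\ uniq L,
        {in L, forall B, {subset B <= s} /\ #|` B| = p},
        {in L &, forall B B', B != B' -> separated B B' \/ separated B' B}
      & size s <= (2 * p - 1) * size L].
Proof.
move=> p_gt0; have [m] := ubnP (size s); elim: m s => // m IH s lt_sm le_ps s_srt.
set A := [fset x in take p s].
have memA x : (x \in A) = (x \in take p s) by rewrite !inE.
have us : uniq s by apply: (sorted_uniq ltn_trans ltnn).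
have cardA : #|` A| = p.
  by rewrite card_fseq undup_id ?take_uniq // size_takel.
have subA : {subset A <= s} by move=> x; rewrite memA; apply: mem_take.
(* Below [2 * p] elements, the single block [A] accounts for all of [s]; otherwise at least [p]
   elements remain after [A] and the induction applies to them. *)
case: (ltnP (size s) (2 * p)) => [small|large].
  exists [:: A]; split=> //=; last by lia.
  - by move=> B; rewrite inE => /eqP ->.
  - by move=> B B'; rewrite !inE => /eqP -> /eqP ->; rewrite eqxx.
have [||| L [uL memL sepL sizeL]] := IH (drop p s).
- by rewrite size_drop; lia.
- by rewrite size_drop; lia.
- by apply: drop_sorted.
have sepA B : B \in L -> separated A B.
  move=> /memL [subB _] x y; rewrite memA => xA /subB yB.
  move: s_srt; rewrite -{1}(cat_take_drop p s) (sorted_pairwise ltn_trans).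
  by rewrite pairwise_cat => /andP [/allrelP lt_td _]; apply: lt_td.
exists (A :: L); split=> /=.
(* If [A] recurred in [L], this nonempty set would be separated from itself. *)
- rewrite uL andbT; apply/negP => AL.
  have /fset0Pn [x xA] : A != fset0 by rewrite -cardfs_gt0 cardA.
  by have := sepA _ AL x x xA xA; rewrite ltnn.
- move=> B; rewrite inE => /predU1P [->//|/memL [subB cardB]]; split=> // x /subB.
  exact: mem_drop.
- move=> B B'; rewrite !inE => /predU1P [->|BL] /predU1P [->|BL'].
  + by rewrite eqxx.
  + by left; apply: sepA.
  + by right; apply: sepA.
  + exact: sepL.
- by rewrite size_drop in sizeL; lia.
Qed.

(** Nonemptiness sits under the existential so that [choice] can later pick a cut for every set at
    once. *)
Lemma cut_exists (p : nat) (E : {fset nat}) :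
  0 < p -> exists L, E != fset0 -> is_cut p E L.
Proof.
move=> p_gt0; case: (ltnP #|` E| p) => [small|large].
  exists [:: E] => E_neq0; split=> //; last by rewrite muln1 (leq_trans (ltnW small)) //; lia.
  - by move=> B; rewrite inE => /eqP ->; split=> //; right.
  - by move=> B B'; rewrite !inE => /eqP -> /eqP ->; rewrite eqxx.
have [||L [uL memL sepL sizeL]] := @sorted_cut p (sort leq E) p_gt0.
- by rewrite size_sort.
- by rewrite ltn_sorted_uniq_leq sort_uniq fset_uniq sort_sorted //; exact: leq_total.
exists L => _; split=> //; last by rewrite size_sort in sizeL.
move=> B /memL [subB cardB]; split; [|by rewrite -cardfs_gt0 cardB|by left].
by apply/fsubsetP => x /subB; rewrite mem_sort.
Qed.

Lemma separated_pullback (V E1 E2 B1 B2 : {fset nat}) (phi : nat -> nat) :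
  {in V &, {homo phi : u v / u < v}} -> E1 `<=` V -> E2 `<=` V ->
  {in E1, forall v, phi v \in B1} -> {in E2, forall v, phi v \in B2} ->
  separated B1 B2 -> separated E1 E2.
Proof.
move=> phi_homo /fsubsetP sub1 /fsubsetP sub2 phi1 phi2 sepB x y xE yE.
have := sepB _ _ (phi1 _ xE) (phi2 _ yE); case: (ltngtP x y) => // [yx|->].
  by have := phi_homo _ _ (sub2 _ yE) (sub1 _ xE) yx; lia.
by rewrite ltnn.
Qed.

Lemma size_le_count_undup (T : eqType) (s : seq T) (k : nat) :
  {in s, forall x, count_mem x s <= k} -> size s <= k * size (undup s).
Proof.
move=> le_k; rewrite -(perm_size (perm_count_undup s)).
rewrite size_flatten /shape -map_comp sumnE big_map /= -sum1_size big_distrr /=.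
rewrite big_seq [leqRHS]big_seq; apply: leq_sum => x.
by rewrite mem_undup muln1 size_nseq; apply: le_k.
Qed.

Section Blocks.

Variables (F H : hypergraph) (blocks : {fset nat} -> seq {fset nat}).

Let p := nvert F.

Hypothesis F_gt1 : 1 < nedge F.
Hypothesis Fsep : ~ exists E1 E2 : {fset nat},
  [/\ E1 \in edges F, E2 \in edges F & separated E1 E2].
Hypothesis freeH : free F H.
Hypothesis simpleH : simple H.
Hypothesis blocksP : forall E, E \in edges H -> is_cut p E (blocks E).

Let all_blocks := flatten (map blocks H).

Lemma mem_all_blocks B :
  reflect (exists2 E, E \in edges H & B \in blocks E) (B \in all_blocks).
Proof. exact: flatten_mapP. Qed.

Lemma count_block B : B \in all_blocks -> count_mem B all_blocks <= nedge F - 1.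
Proof.
move=> /mem_all_blocks [E0 E0H BE0].
(* A cut has no repetitions, so the multiplicity of [B] is the number of edges having [B] as a
   block. *)
have -> : count_mem B all_blocks = size [seq E <- edges H | B \in blocks E].
  rewrite count_flatten -map_comp sumnE big_map size_filter -sum1_count [RHS]big_mkcond.
  rewrite !(big_seq _ _ (edges H)) /=; apply: eq_bigr => E EH.
  by have [uE _ _ _] := blocksP EH; rewrite count_uniq_mem //; case: (_ \in _).
set s := filter _ _; have us : uniq s by apply: filter_uniq.
have sH : {subset s <= edges H} by move=> E; rewrite mem_filter => /andP [].
have [_ mem0 _ _] := blocksP E0H; have [_ _ cardB] := mem0 _ BE0.
rewrite leqNgt; apply/negP => lt_s.
case: cardB => [cardB|[_ smallB]].
  apply: freeH; apply: (@contains_of_common_subset H F B s) => //.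
  - by rewrite cardB.
  - move=> E; rewrite mem_filter => /andP [BE EH].
    by have [_ memE _ _] := blocksP EH; have [] := memE _ BE.
  - by lia.
(* A block with fewer than [p] vertices is the whole edge, so by simplicity only one edge yields it,
   and [1 <= q - 1]. *)
have : size s <= size [:: B].
  apply: uniq_leq_size => // E; rewrite mem_filter inE => /andP [BE EH].
  have [_ memE _ _] := blocksP EH; have [_ _ [cardB|[-> //]]] := memE _ BE.
  by rewrite cardB ltnn in smallB.
by rewrite /=; lia.
Qed.

Lemma block_hypergraph_neq0 : fset0 \notin undup all_blocks.
Proof.
rewrite mem_undup; apply/mem_all_blocks => -[E EH BE].
by have [_ memE _ _] := blocksP EH; have [_ /eqP] := memE _ BE.
Qed.

Let blockH := Hypergraph block_hypergraph_neq0.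

Lemma block_hypergraph_free : free F blockH.
Proof.
case=> phi [f [_ phi_homo f_inj phi_edge]]; apply: freeH.
(* A block may come from several edges; the first one in [H] is chosen. *)
pose origin B := nth fset0 H (find (fun E => B \in blocks E) H).
have originP i : (origin (edge (f i)) \in edges H) /\
                 (edge (f i) \in blocks (origin (edge (f i)))).
  have /mem_all_blocks [E EH BE] : edge (f i) \in all_blocks.
    by rewrite -mem_undup; apply: mem_nth.
  have hasB : has (fun E => edge (f i) \in blocks E) H by apply/hasP; exists E.
  by split; [rewrite mem_nth // -has_find|apply: (nth_find fset0 hasB)].
apply: (@contains_of_edges H F phi (fun i => origin (edge (f i)))) => //.
(* Distinct blocks with a common origin are separated; pulling this back along [phi] would give two
   separated edges of [F]. *)
- move=> i j eq_o; apply: f_inj; apply/eqP/contraT => neq_f.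
  have [oH Bi] := originP i; have [_ Bj] := originP j; rewrite -eq_o in Bj.
  have neqB : edge (f i) != edge (f j).
    by apply: contra neq_f; rewrite nth_uniq ?undup_uniq // => /eqP /val_inj ->.
  have edgeF (k : 'I_(size F)) : edge k \in edges F by apply: mem_nth.
  have sub k : @edge F k `<=` vertices F by apply: edge_sub_vertices.
  have phiE k : {in edge k, forall v, phi v \in edge (f k)} by move=> v; apply: phi_edge.
  have [_ _ sepL _] := blocksP oH.
  case: Fsep; case: (sepL _ _ Bi Bj neqB) => sep_ij.
    exists (edge i), (edge j); split=> //.
    exact: separated_pullback phi_homo (sub i) (sub j) (phiE i) (phiE j) sep_ij.
  exists (edge j), (edge i); split=> //.
  exact: separated_pullback phi_homo (sub j) (sub i) (phiE j) (phiE i) sep_ij.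
- by move=> i; have [] := originP i.
- move=> v i /phi_edge; apply: fsubsetP.
  have [oH Bi] := originP i; have [_ memo _ _] := blocksP oH.
  by have [] := memo _ Bi.
Qed.

Lemma nvert_block_hypergraph : nvert blockH <= nvert H.
Proof.
apply/fsubset_leq_card/fsubsetP => x /bigfcupP [B]; rewrite andbT /= mem_undup.
move=> /mem_all_blocks [E EH BE] xB.
have [_ memE _ _] := blocksP EH; have [/fsubsetP subB _ _] := memE _ BE.
by apply: (fsubsetP (edge_sub_vertices EH)); apply: subB.
Qed.

(** The first factor bounds incidences per block counted with multiplicity, the second the
    multiplicity of each distinct block. *)
Lemma nincid_le_blocks : nincid H <= (2 * p - 1) * (nedge F - 1) * nedge blockH.
Proof.
apply: (@leq_trans ((2 * p - 1) * size all_blocks)); last first.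
  by rewrite -mulnA leq_mul2l size_le_count_undup ?orbT //; apply: count_block.
rewrite size_flatten /shape -map_comp sumnE big_map big_distrr /=.
rewrite /nincid big_seq [leqRHS]big_seq; apply: leq_sum => E EH.
by have [] := blocksP EH.
Qed.

Lemma nincid_le_ex_e (n : nat) : nvert H <= n ->
  nincid H <= (2 * p - 1) * (nedge F - 1) * ex_e F n.
Proof.
move=> vH; apply: leq_trans nincid_le_blocks _; rewrite leq_mul2l; apply/orP; right.
(* [blockH] is admissible, hence competes in the maximum defining [ex_e F n]. *)
have [_ le_ex] := ex_eP n (ltnW F_gt1); apply: le_ex; exists blockH => //.
split; first exact: block_hypergraph_free.
- exact: undup_uniq.
- exact: leq_trans nvert_block_hypergraph vH.
Qed.

End Blocks.

Lemma nvert_gt0 (F : hypergraph) : 0 < nedge F -> 0 < nvert F.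
Proof.
move=> F_gt0; pose i := Ordinal F_gt0.
have iF : edge i \in edges F by apply: mem_nth.
apply: leq_trans (fsubset_leq_card (edge_sub_vertices iF)).
by rewrite cardfs_gt0; apply: contraNneq (edges_neq0 F) => <-.
Qed.

Theorem theorem1 (F : hypergraph) (p q : nat)
    (hsep : ~ exists E1 E2 : {fset nat},
        [/\ E1 \in edges F, E2 \in edges F & separated E1 E2])
    (hp : p = nvert F) (hq : q = nedge F) (hq1 : 1 < q) (n : nat) :
  ex_i F n <= (2 * p - 1) * (q - 1) * ex_e F n.
Proof.
rewrite hq in hq1 *; rewrite hp.
(* Take [H] attaining [ex_i F n]. *)
have [[H [freeH simpleH vH] <-] _] := ex_iP n (ltnW hq1).
have [blocks blocksP] := choice (fun E => cut_exists E (nvert_gt0 (ltnW hq1))).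
apply: (@nincid_le_ex_e F H blocks) => // E EH; apply: blocksP.
by apply: contraTneq EH => ->; apply: edges_neq0.
Qed.
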